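(* Let $\tau>0$, let $\phi=\phi^{m,n}_{p,q}\big({\mathbf a\atop\mathbf b}\big|s\big)$, and put $\kappa=(2\pi)^{(1-\tau)/2}$. For every $c\in\mathbb{C}$ and each multiplier $R$ listed below, $$R(s)\,\phi^{m,n}_{p,q}\!\left(\begin{matrix}\mathbf a\\ \mathbf b\end{matrix}\middle|s\right)=C\,\lambda^{-s}\,\phi^{m',n'}_{p',q'}\!\left(\begin{matrix}\mathbf a'\\ \mathbf b'\end{matrix}\middle|s\right),\qquad\text{equivalently}\qquad \frac{1}{2\pi i}\int_\gamma R(s)\phi(s)z^{-s}ds=C\,K'(\lambda z),$$ with $\alpha$ (and $\tau$) unchanged, where $K'(x)=\frac{1}{2\pi i}\int_\gamma\phi^{m',n'}_{p',q'}\big({\mathbf a'\atop\mathbf b'}\big|s\big)x^{-s}ds$, and where $C$, $\lambda$ and the one new $a$-parameter and one new $b$-parameter are: 1. $R(s)=\Gamma(c-s)$: $C=\kappa\tau^{c-\frac12}$, $\lambda=\tau$; new $a$-parameter $c$ in the denominator block; new $b$-parameter $c+\tau$ in the numerator block. 2. $R(s)=\Gamma(c+s)$: $C=\kappa\tau^{c-\frac12}$, $\lambda=\tau^{-1}$; new $a$-parameter $1-c$ in the numerator block; new $b$-parameter $1+\tau-c$ in the denominator block. 3. $R(s)=1/\Gamma(c-s)$: $C=\kappa^{-1}\tau^{\frac12-c}$, $\lambda=\tau^{-1}$; new $a$-parameter $c+\tau$ in the denominator block; new $b$-parameter $c$ in the numerator block. 4. $R(s)=1/\Gamma(c+s)$: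 $C=\kappa^{-1}\tau^{\frac12-c}$, $\lambda=\tau$; new $a$-parameter $1+\tau-c$ in the numerator block; new $b$-parameter $1-c$ in the denominator block. A new $a$-parameter in the numerator block increments $n$ and $p$ by one; in the denominator block it increments $p$ only. A new $b$-parameter in the numerator block increments $m$ and $q$; in the denominator block it increments $q$ only.
   Context: For $\tau>0$, $G(z;\tau)$ is the Barnes double gamma function: the entire function $G(z;\tau)=\frac{z}{\tau}e^{c_1 z/\tau+c_2 z^2/(2\tau^2)}\prod_{(k,l)\in\mathbb{Z}_{\ge0}^2\setminus\{(0,0)\}}\big(1+\frac{z}{k\tau+l}\big)e^{-\frac{z}{k\tau+l}+\frac{z^2}{2(k\tau+l)^2}}$, with real constants $c_1,c_2$ (depending on $\tau$) uniquely determined by $G(z+1;\tau)=\Gamma(z/\tau)G(z;\tau)$ and $G(z+\tau;\tau)=(2\pi)^{(\tau-1)/2}\tau^{1/2-z}\Gamma(z)G(z;\tau)$. For integers $0\le m\le q$, $0\le n\le p$, $\mathbf a\in\mathbb{C}^p$, $\mathbf b\in\mathbb{C}^q$, $\alpha\in\mathbb{C}$, $$\phi^{m,n}_{p,q}\!\left(\begin{matrix}\mathbf a\\ \mathbf b\end{matrix}\middle|s\right)=\frac{\prod_{j=1}^{m}G(b_j-s;\tau)\prod_{j=1}^{n}G(1+\tau-a_j+s;\tau)}{\prod_{j=m+1}^{q}G(1+\tau-b_j+s;\tau)\prod_{j=n+1}^{p}G(a_j-s;\tau)}\,e^{\pi\alpha s^2/\tau}.$$ The numerator block consists of $a_1,\dots,a_n$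 and $b_1,\dots,b_m$; the denominator block of $a_{n+1},\dots,a_p$ and $b_{m+1},\dots,b_q$. The order of parameters within a block is immaterial. $\gamma$ is an integration contour (on which the integrals considered make sense); $z$ is on the Riemann surface of the logarithm, $z^{-s}=e^{-s\log z}$, and $\log(\lambda z)=\ln\lambda+\log z$. *)

(* Defs.v *)
(* Stdlib reals with Coquelicot's complex numbers. *)
From Stdlib Require Export Reals Factorial List Permutation.
From Coquelicot Require Export Coquelicot.

Open Scope C_scope.

(** * Elementary complex functions *)

Definition Cexp (z : C) : C :=
  ((exp (Re z) * cos (Im z))%R, (exp (Re z) * sin (Im z))%R).

(* x^w for a positive real base x. *)
Definition rcpow (x : R) (w : C) : C := Cexp (w * ln x).

Definition Cprod (l : list C) : C := fold_right Cmult 1 l.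

(* The limit of a convergent complex sequence, taken componentwise. *)
Definition Clim (u : nat -> C) : C :=
  (real (Lim_seq (fun n => Re (u n))), real (Lim_seq (fun n => Im (u n)))).

Definition nonpos_int (z : C) : Prop := exists k : nat, z = - INR k.

(* Gauss's limit.  At a pole z = -k the partial products eventually have
   denominator 0, so the convention / 0 = 0 gives Gamma z = 0 there; hence
   / Gamma z is the entire function 1/Gamma at every z, poles included. *)
Definition Gamma (z : C) : C :=
  Clim (fun N => rcpow (INR N) z * INR (fact N)
                 / Cprod (map (fun k => z + INR k) (seq 0 (S N)))).

(** * The Barnes double gamma function *)

Definition barnes_factor (tau : R) (z : C) (kl : nat * nat) : C :=
  match kl with
  | (O, O) => 1
  | (k, l) =>
      let w : C := (INR k * tau + INR l)%R in
      (1 + z / w) * Cexp (- (z / w) + z ^ 2 / (2 * w ^ 2))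
  end.

(* The product over (k,l) converges absolutely, so the exhaustion by squares
   computes it. *)
Definition barnes_product (tau : R) (z : C) : C :=
  Clim (fun N => Cprod (map (barnes_factor tau z)
                            (list_prod (seq 0 (S N)) (seq 0 (S N))))).

Definition barnes_G (tau c1 c2 : R) (z : C) : C :=
  z / tau * Cexp (c1 * z / tau + c2 * z ^ 2 / (2 * tau ^ 2))
  * barnes_product tau z.

(* The property that singles out the real constants c1, c2. *)
Definition barnes_constants (tau c1 c2 : R) : Prop :=
  let G := barnes_G tau c1 c2 in
  (forall z : C, ~ nonpos_int (z / tau) ->
     G (z + 1) = Gamma (z / tau) * G z) /\
  (forall z : C, ~ nonpos_int z ->
     G (z + tau) = Rpower (2 * PI) ((tau - 1) / 2) * rcpow tau (1 / 2 - z)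
                   * Gamma z * G z).

(** * The kernel phi

   Parameter vectors are lists, with p = length a and q = length b.  The
   first n entries of a and the first m entries of b are the numerator
   blocks; the remaining entries are the denominator blocks. *)

Definition phi_num (G : C -> C) (tau : R) (m n : nat) (a b : list C) (s : C) : C :=
  Cprod (map (fun bj => G (bj - s)) (firstn m b))
  * Cprod (map (fun aj => G (1 + tau - aj + s)) (firstn n a)).

Definition phi_den (G : C -> C) (tau : R) (m n : nat) (a b : list C) (s : C) : C :=
  Cprod (map (fun bj => G (1 + tau - bj + s)) (skipn m b))
  * Cprod (map (fun aj => G (aj - s)) (skipn n a)).

Definition phi (G : C -> C) (tau : R) (alpha : C) (m n : nat) (a b : list C)
    (s : C) : C :=
  phi_num G tau m n a b s / phi_den G tau m n a b s
  * Cexp (PI * alpha * s ^ 2 / tau).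

(* v' is v with x inserted in the numerator block (whose length k becomes
   k+1), resp. in the denominator block, in any position; the order inside
   each block is left free. *)
Definition add_num (k : nat) (x : C) (v v' : list C) : Prop :=
  Permutation (x :: firstn k v) (firstn (S k) v') /\
  Permutation (skipn k v) (skipn (S k) v').

Definition add_den (k : nat) (x : C) (v v' : list C) : Prop :=
  Permutation (firstn k v) (firstn k v') /\
  Permutation (x :: skipn k v) (skipn k v').

(** * The Riemann surface of the logarithm *)

(* The logarithm is a global coordinate on this surface. *)
Record log_surface : Type := LogPoint { logz : C }.

Definition scale (lam : R) (z : log_surface) : log_surface :=
  LogPoint (ln lam + logz z).

Definition zpow (z : log_surface) (w : C) : C := Cexp (w * logz z).

(** * Contour integrals *)

(* A piecewise continuously differentiable path on an open, possibly
   unbounded, interval; break points are finite in number on every compact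
   subinterval. *)
Record contour : Type := Contour {
  lo : Rbar;
  hi : Rbar;
  path : R -> C;
  path_ends : Rbar_lt lo hi;
  path_cont : forall t : R, Rbar_lt lo t -> Rbar_lt t hi ->
    continuous (fun t => path t : C_UniformSpace) t;
  path_C1 : forall x y : R, Rbar_lt lo x -> Rbar_lt y hi ->
    exists l : list R, forall t : R, (x <= t <= y)%R -> ~ In t l ->
      ex_derive (fun t => Re (path t)) t /\
      ex_derive (fun t => Im (path t)) t /\
      continuous (Derive (fun t => Re (path t))) t /\
      continuous (Derive (fun t => Im (path t))) t
}.

Definition velocity (g : contour) (t : R) : C :=
  (Derive (fun t => Re (path g t)) t, Derive (fun t => Im (path g t)) t).

Definition lo_filter (g : contour) : (R -> Prop) -> Prop :=
  within (fun t => Rbar_lt (lo g) t) (Rbar_locally (lo g)).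

Definition hi_filter (g : contour) : (R -> Prop) -> Prop :=
  within (fun t => Rbar_lt t (hi g)) (Rbar_locally (hi g)).

(* Riemann integrals over compact subintervals, improper at both ends. *)
Definition ex_contour_int (g : contour) (f : C -> C) : Prop :=
  ex_RInt_gen (V := C_R_NormedModule)
    (fun t => f (path g t) * velocity g t) (lo_filter g) (hi_filter g).

Definition contour_int (g : contour) (f : C -> C) : C :=
  RInt_gen (V := C_R_CompleteNormedModule)
    (fun t => f (path g t) * velocity g t) (lo_filter g) (hi_filter g).

Definition ex_K_int (g : contour) (f : C -> C) (z : log_surface) : Prop :=
  ex_contour_int g (fun s => f s * zpow z (- s)).

Definition K_int (g : contour) (f : C -> C) (z : log_surface) : C :=
  / (2 * PI * Ci) * contour_int g (fun s => f s * zpow z (- s)).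

(* The contour meets the zeros of D at finitely many times on every compact
   subinterval. *)
Definition isolated_zeros_on (g : contour) (D : C -> C) : Prop :=
  forall x y : R, Rbar_lt (lo g) x -> Rbar_lt y (hi g) ->
    exists l : list R, forall t : R, (x <= t <= y)%R -> ~ In t l ->
      D (path g t) <> 0.

(** * Absorbing a multiplier *)

(* In each use below, a zero of the denominator D of phi' includes every zero
   of the denominator of phi and every pole of mult, so both sides of the first
   identity are genuine quotients where D does not vanish.  Off the zeros of
   D it is the identity of meromorphic functions; isolated passages of a
   contour through such zeros (removable singularities) are allowed. *)
Definition absorbs (mult f : C -> C) (cst : C) (lam : R)
    (f' D : C -> C) : Prop :=
  (forall s : C, D s <> 0 -> mult s * f s = cst * rcpow lam (- s) * f' s) /\
  (forall (g : contour) (z : log_surface), isolated_zeros_on g D ->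
     (ex_K_int g (fun s => mult s * f s) z <-> ex_K_int g f' (scale lam z)) /\
     (ex_K_int g f' (scale lam z) ->
        K_int g (fun s => mult s * f s) z = cst * K_int g f' (scale lam z))).

(* Main.v *)
Require Import Defs.
From Stdlib Require Import Lra Lia Classical.

(**
The shift relation
  G (z + tau) = kappa^(-1) tau^(1/2 - z) Gamma(z) G(z)
turns Gamma(z) into kappa tau^(z - 1/2) times the quotient G (z + tau) / G z.
Taking z = c - s or z = c + s, the factor tau^(z - 1/2) splits into the
constant tau^(c - 1/2) and the power tau^(-s) or tau^s, while G (z + tau) and
G z are exactly the factors of phi contributed by one new b-parameter and one
new a-parameter.  The reciprocal multipliers use the inverted relation.

The relation is given only away from the poles z = 0, -1, -2, ... of Gamma.
At these points G vanishes ([barnes_G_nonpos_int]), which settles the two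
remaining cases: for the multiplier Gamma, G z is a factor of the denominator,
so such points are excluded; for / Gamma, both sides are 0.  This gives the
pointwise statements [Gamma_eq_barnes_quotient] and
[inv_Gamma_eq_barnes_quotient].

The integral statement follows from the pointwise one ([absorbs_of_pointwise]):
lambda^(-s) z^(-s) = (lambda z)^(-s), the two integrands agree on every compact
parameter interval outside a finite set, which a Riemann integral does not see
([is_RInt_ext_finite]), and a nonzero complex constant can be moved in and out
of an improper integral ([is_RInt_gen_Cmult]).
*)

(** * Exponentials and products *)

Lemma Cexp_plus : forall x y : C, Cexp (x + y) = Cexp x * Cexp y.
Proof.
  intros [x1 x2] [y1 y2]; unfold Cexp, Cmult, Cplus, Re, Im; simpl.
  rewrite exp_plus, cos_plus, sin_plus.
  apply injective_projections; simpl; ring.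
Qed.

Lemma Cexp_0 : Cexp 0 = 1.
Proof.
  unfold Cexp, RtoC; simpl; rewrite exp_0, cos_0, sin_0.
  apply injective_projections; simpl; ring.
Qed.

Lemma Cexp_neq_0 : forall x : C, Cexp x <> 0.
Proof.
  intros x Hx; apply C1_nz.
  rewrite <- Cexp_0, <- (Cplus_opp_r x), Cexp_plus, Hx; ring.
Qed.

Lemma rcpow_plus : forall (x : R) (u v : C),
  rcpow x (u + v) = rcpow x u * rcpow x v.
Proof.
  intros x u v; unfold rcpow; rewrite <- Cexp_plus; f_equal; ring.
Qed.

Lemma rcpow_neq_0 : forall (x : R) (u : C), rcpow x u <> 0.
Proof. intros; apply Cexp_neq_0. Qed.

Lemma rcpow_0 : forall x : R, rcpow x 0 = 1.
Proof. intros x; unfold rcpow; rewrite Cmult_0_l; apply Cexp_0. Qed.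

Lemma rcpow_Rinv : forall (x : R) (u : C), (0 < x)%R ->
  rcpow (/ x) u = rcpow x (- u).
Proof.
  intros x u Hx; unfold rcpow; rewrite ln_Rinv, RtoC_opp by exact Hx.
  f_equal; ring.
Qed.

Lemma Cinv_0 : / (0 : C) = 0.
Proof.
  unfold Cinv, RtoC; simpl; apply injective_projections; simpl;
    unfold Rdiv; ring.
Qed.

Lemma Cmult_neq_0_l : forall x y : C, x * y <> 0 -> x <> 0.
Proof. intros x y H Hx; apply H; rewrite Hx; ring. Qed.

Lemma Cmult_neq_0_r : forall x y : C, x * y <> 0 -> y <> 0.
Proof. intros x y H Hy; apply H; rewrite Hy; ring. Qed.

Lemma Cprod_perm : forall l l' : list C,
  Permutation l l' -> Cprod l = Cprod l'.
Proof.
  intros l l' H; induction H; unfold Cprod in *; simpl; try congruence; ring.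
Qed.

Lemma Cprod_eq_0 : forall l : list C, In (RtoC 0) l -> Cprod l = 0.
Proof.
  intros l; induction l as [|x l IH]; simpl; intros H; [easy|].
  fold (Cprod l); destruct H as [-> | H]; [|rewrite (IH H)]; ring.
Qed.

Lemma Clim_eventually_0 : forall u : nat -> C,
  eventually (fun N => u N = 0) -> Clim u = 0.
Proof.
  intros u Hu; unfold Clim.
  rewrite (Lim_seq_ext_loc _ (fun _ => 0%R)), Lim_seq_const.
  2: revert Hu; apply filter_imp; intros N ->; reflexivity.
  rewrite (Lim_seq_ext_loc _ (fun _ => 0%R)), Lim_seq_const.
  2: revert Hu; apply filter_imp; intros N ->; reflexivity.
  reflexivity.
Qed.

(** * Gamma and the double gamma function at nonpositive integers *)

(** The value 0 is the one forced by the conventions on limits and division;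
    it makes [/ Gamma z = 0] at the poles. *)
Lemma Gamma_nonpos_int : forall z : C, nonpos_int z -> Gamma z = 0.
Proof.
  intros z [k ->]; apply Clim_eventually_0; exists k; intros N HN.
  rewrite (Cprod_eq_0 (map _ _)).
  - unfold Cdiv; rewrite Cinv_0; ring.
  - apply in_map_iff; exists k; split; [ring|].
    apply in_seq; lia.
Qed.

Lemma barnes_G_nonpos_int : forall (tau c1 c2 : R) (z : C),
  nonpos_int z -> barnes_G tau c1 c2 z = 0.
Proof.
  intros tau c1 c2 z [[|k] ->]; unfold barnes_G.
  - simpl; unfold Cdiv; ring.
  - unfold barnes_product.
    rewrite (Clim_eventually_0 (fun N => Cprod _)); [ring|].
    exists (S k); intros N HN; apply Cprod_eq_0.
    (* the factor indexed by (0, k + 1) is the one that vanishes *)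
    apply in_map_iff; exists (O, S k); split.
    + unfold barnes_factor.
      replace (INR 0 * tau + INR (S k))%R with (INR (S k)) by (simpl INR at 2; ring).
      assert (Hk : RtoC (INR (S k)) <> 0).
      { intros H; apply RtoC_inj in H; revert H; apply not_0_INR; lia. }
      replace (1 + - RtoC (INR (S k)) / RtoC (INR (S k))) with (RtoC 0)
        by (field; exact Hk).
      ring.
    + apply in_prod; apply in_seq; lia.
Qed.

Lemma kappa_inverse : forall tau : R,
  RtoC (Rpower (2 * PI) ((1 - tau) / 2)) * Rpower (2 * PI) ((tau - 1) / 2) = 1.
Proof.
  intros tau; rewrite <- RtoC_mult, <- Rpower_plus.
  replace ((1 - tau) / 2 + (tau - 1) / 2)%R with 0%R by field.
  rewrite Rpower_O; [reflexivity|].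
  generalize PI_RGT_0; lra.
Qed.

Lemma RtoC_Rpower_neq_0 : forall x y : R, RtoC (Rpower x y) <> 0.
Proof.
  intros x y H; apply RtoC_inj in H; revert H.
  apply Rgt_not_eq, exp_pos.
Qed.

Lemma Gamma_eq_barnes_quotient : forall (tau c1 c2 : R) (z : C),
  barnes_constants tau c1 c2 -> barnes_G tau c1 c2 z <> 0 ->
  Gamma z = Rpower (2 * PI) ((1 - tau) / 2) * rcpow tau (z - 1 / 2)
            * (barnes_G tau c1 c2 (z + tau) / barnes_G tau c1 c2 z).
Proof.
  intros tau c1 c2 z [_ HG] Hz.
  rewrite HG by (intros H; apply Hz, barnes_G_nonpos_int, H).
  assert (Hpow : rcpow tau (z - 1 / 2) * rcpow tau (1 / 2 - z) = 1).
  { rewrite <- rcpow_plus, <- (rcpow_0 tau); f_equal; ring. }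
  transitivity
    ((RtoC (Rpower (2 * PI) ((1 - tau) / 2)) * Rpower (2 * PI) ((tau - 1) / 2))
     * (rcpow tau (z - 1 / 2) * rcpow tau (1 / 2 - z)) * Gamma z).
  - rewrite kappa_inverse, Hpow; ring.
  - field; exact Hz.
Qed.

Lemma inv_Gamma_eq_barnes_quotient : forall (tau c1 c2 : R) (z : C),
  barnes_constants tau c1 c2 -> barnes_G tau c1 c2 (z + tau) <> 0 ->
  / Gamma z = / RtoC (Rpower (2 * PI) ((1 - tau) / 2)) * rcpow tau (1 / 2 - z)
              * (barnes_G tau c1 c2 z / barnes_G tau c1 c2 (z + tau)).
Proof.
  intros tau c1 c2 z [_ HG] Hz.
  destruct (classic (nonpos_int z)) as [Hn | Hn].
  - rewrite Gamma_nonpos_int, Cinv_0, barnes_G_nonpos_int by exact Hn.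
    unfold Cdiv; ring.
  - rewrite HG in Hz |- * by exact Hn.
    assert (HGz := Cmult_neq_0_r _ _ Hz).
    assert (HGam := Cmult_neq_0_r _ _ (Cmult_neq_0_l _ _ Hz)).
    replace (/ RtoC (Rpower (2 * PI) ((1 - tau) / 2)))
      with (RtoC (Rpower (2 * PI) ((tau - 1) / 2))).
    + field; repeat split; auto using RtoC_Rpower_neq_0, rcpow_neq_0.
    + rewrite <- (Cmult_1_l (/ _)), <- (kappa_inverse tau).
      field; apply RtoC_Rpower_neq_0.
Qed.

(** * Adding a pair of parameters to the kernel *)

Lemma Cprod_add_num : forall (f : C -> C) (k : nat) (x : C) (v v' : list C),
  add_num k x v v' ->
  Cprod (map f (firstn (S k) v')) = f x * Cprod (map f (firstn k v)) /\
  Cprod (map f (skipn (S k) v')) = Cprod (map f (skipn k v)).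
Proof.
  intros f k x v v' [H1 H2]; split; symmetry;
    [apply (Cprod_perm (map f (x :: _))) | apply Cprod_perm];
    apply Permutation_map; assumption.
Qed.

Lemma Cprod_add_den : forall (f : C -> C) (k : nat) (x : C) (v v' : list C),
  add_den k x v v' ->
  Cprod (map f (firstn k v')) = Cprod (map f (firstn k v)) /\
  Cprod (map f (skipn k v')) = f x * Cprod (map f (skipn k v)).
Proof.
  intros f k x v v' [H1 H2]; split; symmetry;
    [apply Cprod_perm | apply (Cprod_perm (map f (x :: _)))];
    apply Permutation_map; assumption.
Qed.

Lemma phi_den_add_den_num : forall (G : C -> C) (tau : R) (m n : nat)
    (x y : C) (a a' b b' : list C) (s : C),
  add_den n x a a' -> add_num m y b b' ->
  phi_den G tau (S m) n a' b' s = G (x - s) * phi_den G tau m n a b s.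
Proof.
  intros G tau m n x y a a' b b' s Ha Hb; unfold phi_den.
  rewrite (proj2 (Cprod_add_num _ _ _ _ _ Hb)).
  rewrite (proj2 (Cprod_add_den _ _ _ _ _ Ha)); ring.
Qed.

Lemma phi_den_add_num_den : forall (G : C -> C) (tau : R) (m n : nat)
    (x y : C) (a a' b b' : list C) (s : C),
  add_num n x a a' -> add_den m y b b' ->
  phi_den G tau m (S n) a' b' s =
    G (1 + tau - y + s) * phi_den G tau m n a b s.
Proof.
  intros G tau m n x y a a' b b' s Ha Hb; unfold phi_den.
  rewrite (proj2 (Cprod_add_num _ _ _ _ _ Ha)).
  rewrite (proj2 (Cprod_add_den _ _ _ _ _ Hb)); ring.
Qed.

Lemma phi_add_den_num : forall (G : C -> C) (tau : R) (alpha : C) (m n : nat)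
    (x y : C) (a a' b b' : list C) (s : C),
  add_den n x a a' -> add_num m y b b' ->
  phi_den G tau (S m) n a' b' s <> 0 ->
  phi G tau alpha (S m) n a' b' s =
    G (y - s) / G (x - s) * phi G tau alpha m n a b s.
Proof.
  intros G tau alpha m n x y a a' b b' s Ha Hb HD; unfold phi.
  rewrite (phi_den_add_den_num _ _ _ _ _ _ _ _ _ _ _ Ha Hb) in HD |- *.
  unfold phi_num.
  rewrite (proj1 (Cprod_add_num _ _ _ _ _ Hb)).
  rewrite (proj1 (Cprod_add_den _ _ _ _ _ Ha)).
  generalize (Cexp (PI * alpha * s ^ 2 / tau)); intros e.
  field; split; [apply (Cmult_neq_0_r _ _ HD) | apply (Cmult_neq_0_l _ _ HD)].
Qed.

Lemma phi_add_num_den : forall (G : C -> C) (tau : R) (alpha : C) (m n : nat)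
    (x y : C) (a a' b b' : list C) (s : C),
  add_num n x a a' -> add_den m y b b' ->
  phi_den G tau m (S n) a' b' s <> 0 ->
  phi G tau alpha m (S n) a' b' s =
    G (1 + tau - x + s) / G (1 + tau - y + s) * phi G tau alpha m n a b s.
Proof.
  intros G tau alpha m n x y a a' b b' s Ha Hb HD; unfold phi.
  rewrite (phi_den_add_num_den _ _ _ _ _ _ _ _ _ _ _ Ha Hb) in HD |- *.
  unfold phi_num.
  rewrite (proj1 (Cprod_add_num _ _ _ _ _ Ha)).
  rewrite (proj1 (Cprod_add_den _ _ _ _ _ Hb)).
  generalize (Cexp (PI * alpha * s ^ 2 / tau)); intros e.
  field; split; [apply (Cmult_neq_0_r _ _ HD) | apply (Cmult_neq_0_l _ _ HD)].
Qed.

(** * Integrals of functions that agree outside a finite set *)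

Lemma is_RInt_zero_off_point : forall (V : NormedModule R_AbsRing)
    (h : R -> V) (p x y : R),
  (forall t, t <> p -> h t = zero) -> is_RInt h x y zero.
Proof.
  intros V h p x y Hh.
  assert (H0 : forall u v, (u = p \/ v = p) -> is_RInt h u v zero).
  { intros u v Huv.
    apply is_RInt_ext with (fun _ => zero : V).
    - intros t Ht; symmetry; apply Hh; intros ->.
      revert Ht; unfold Rmin, Rmax; destruct (Rle_dec u v);
        destruct Huv; subst; lra.
    - assert (Hc := is_RInt_const u v (zero : V)).
      now rewrite (scal_zero_r (v - u)%R : scal (v - u)%R (zero : V) = zero)
        in Hc. }
  assert (Hxy := is_RInt_Chasles h x p y zero zero
                   (H0 x p (or_intror eq_refl)) (H0 p y (or_introl eq_refl))).
  now rewrite (plus_zero_l zero : plus zero (zero : V) = zero) in Hxy.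
Qed.

Lemma minus_minus_cancel : forall (V : AbelianGroup) (x y : V),
  minus x (minus x y) = y.
Proof.
  intros V x y; transitivity (plus x (plus (opp x) y)).
  - apply (f_equal (plus x)), (eq_trans (opp_minus x y)), plus_comm.
  - rewrite plus_assoc.
    exact (eq_trans (f_equal (fun z => plus z y) (plus_opp_r x))
                    (plus_zero_l y)).
Qed.

Lemma is_RInt_ext_finite : forall (V : NormedModule R_AbsRing)
    (l : list R) (f g : R -> V) (x y : R) (v : V),
  (forall t, (Rmin x y <= t <= Rmax x y)%R -> ~ In t l -> f t = g t) ->
  is_RInt f x y v -> is_RInt g x y v.
Proof.
  intros V l; induction l as [|p l IH]; intros f g x y v Hfg Hf.
  - apply is_RInt_ext with (2 := Hf).
    intros t Ht; apply Hfg; [lra | easy].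
  - (* g is first modified at p only, to agree with f there *)
    set (g' := fun t => if Req_dec_T t p then f t else g t).
    assert (Hg' : is_RInt g' x y v).
    { apply IH with (2 := Hf); intros t Ht Hl; unfold g'.
      destruct (Req_dec_T t p); [easy|].
      apply Hfg; [easy|]; intros [H|H]; [now apply n | easy]. }
    rewrite <- (minus_zero_r v : minus v zero = v).
    apply is_RInt_ext with (fun t => minus (g' t) (minus (g' t) (g t))).
    + intros t _; exact (minus_minus_cancel _ (g' t) (g t)).
    + apply is_RInt_minus with (1 := Hg').
      apply is_RInt_zero_off_point with p; intros t Ht; unfold g'.
      destruct (Req_dec_T t p); [easy|].
      exact (minus_eq_zero (g t)).
Qed.

Lemma is_RInt_Cmult : forall (k : C) (f : R -> C) (x y : R) (v : C),
  is_RInt (V := C_R_NormedModule) f x y v ->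
  is_RInt (V := C_R_NormedModule) (fun t => k * f t) x y (k * v).
Proof.
  intros [k1 k2] f x y v Hf.
  assert (H1 := is_RInt_fct_extend_fst (U := R_NormedModule)
                  (V := R_NormedModule) f x y v Hf).
  assert (H2 := is_RInt_fct_extend_snd (U := R_NormedModule)
                  (V := R_NormedModule) f x y v Hf).
  apply (is_RInt_fct_extend_pair (U := R_NormedModule) (V := R_NormedModule)
           (fun t => (k1, k2) * f t) x y); simpl.
  - exact (is_RInt_minus _ _ _ _ _ _
             (is_RInt_scal _ _ _ k1 _ H1) (is_RInt_scal _ _ _ k2 _ H2)).
  - exact (is_RInt_plus _ _ _ _ _ _
             (is_RInt_scal _ _ _ k1 _ H2) (is_RInt_scal _ _ _ k2 _ H1)).
Qed.

Lemma continuous_Cmult_l : forall k v : C,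
  filterlim (fun w : C_UniformSpace => (k * w : C_UniformSpace))
    (locally (v : C_UniformSpace)) (locally (k * v : C_UniformSpace)).
Proof.
  intros k v P HP.
  (* the product and the modulus uniform structures on C have the same
     neighbourhoods *)
  apply (proj1 (locally_C _ _)) in HP.
  apply (proj2 (locally_C _ _)).
  exact (filterlim_scal_r (K := C_AbsRing)
           (V := AbsRing_NormedModule C_AbsRing) k v P HP).
Qed.

(** The scalars of the integral are real, so linearity over C is separate. *)
Lemma is_RInt_gen_Cmult : forall (k : C) (f : R -> C)
    (Fa Fb : (R -> Prop) -> Prop) (v : C),
  Filter Fa -> Filter Fb ->
  is_RInt_gen (V := C_R_NormedModule) f Fa Fb v ->
  is_RInt_gen (V := C_R_NormedModule) (fun t => k * f t) Fa Fb (k * v).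
Proof.
  intros k f Fa Fb v HFa HFb Hf P HP.
  assert (H := Hf _ (continuous_Cmult_l k v P HP)).
  revert H; unfold filtermapi; apply filter_imp; intros [x y] [w [Hw HPw]].
  exists (k * w); split; [now apply is_RInt_Cmult | exact HPw].
Qed.

(** * Contour integrals *)

Lemma within_proper : forall (F : (R -> Prop) -> Prop) (D : R -> Prop),
  Filter F -> ~ F (fun t => ~ D t) -> ProperFilter' (within D F).
Proof.
  intros F D HF HD; constructor.
  - exact HD.
  - now apply within_filter.
Qed.

#[global] Instance lo_filter_proper (g : contour) : ProperFilter' (lo_filter g).
Proof.
  apply (within_proper (Rbar_locally (lo g)) (fun t => Rbar_lt (lo g) t));
    [apply Rbar_locally_filter|].
  assert (H := path_ends g); destruct (lo g) as [r| |]; simpl; intros Hn.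
  - destruct Hn as [e He].
    assert (He0 := cond_pos e).
    apply (He (r + e / 2)%R); [|lra].
    change (Rabs (r + e / 2 - r) < e)%R; rewrite Rabs_pos_eq; lra.
  - destruct (hi g); contradiction.
  - destruct Hn as [M HM]; apply (HM (M - 1)%R); [lra | easy].
Qed.

#[global] Instance hi_filter_proper (g : contour) : ProperFilter' (hi_filter g).
Proof.
  apply (within_proper (Rbar_locally (hi g)) (fun t => Rbar_lt t (hi g)));
    [apply Rbar_locally_filter|].
  assert (H := path_ends g); destruct (hi g) as [r| |]; simpl; intros Hn.
  - destruct Hn as [e He].
    assert (He0 := cond_pos e).
    apply (He (r - e / 2)%R); [|lra].
    change (Rabs (r - e / 2 - r) < e)%R; rewrite Rabs_left1; lra.
  - destruct Hn as [M HM]; apply (HM (M + 1)%R); [lra | easy].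
  - destruct (lo g); contradiction.
Qed.

(** The parameters close to an end of the contour lie strictly between the
    two ends. *)
Lemma lo_filter_inside : forall g : contour,
  lo_filter g (fun t => Rbar_lt (lo g) t /\ Rbar_lt t (hi g)).
Proof.
  intros g; unfold lo_filter, within.
  generalize (open_Rbar_lt' _ _ (path_ends g)).
  apply filter_imp; auto.
Qed.

Lemma hi_filter_inside : forall g : contour,
  hi_filter g (fun t => Rbar_lt (lo g) t /\ Rbar_lt t (hi g)).
Proof.
  intros g; unfold hi_filter, within.
  generalize (open_Rbar_gt' _ _ (path_ends g)).
  apply filter_imp; auto.
Qed.

(** Two functions that agree where [D] does not vanish have the same integral
    along a contour on which the zeros of [D] are isolated. *)
Lemma is_contour_int_ext : forall (g : contour) (D f h : C -> C) (v : C),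
  isolated_zeros_on g D -> (forall s, D s <> 0 -> f s = h s) ->
  is_RInt_gen (V := C_R_NormedModule) (fun t => f (path g t) * velocity g t)
    (lo_filter g) (hi_filter g) v ->
  is_RInt_gen (V := C_R_NormedModule) (fun t => h (path g t) * velocity g t)
    (lo_filter g) (hi_filter g) v.
Proof.
  intros g D f h v HD Hfh Hf P HP.
  assert (HF1 : Filter (lo_filter g)) by apply filter_filter'.
  assert (HF2 : Filter (hi_filter g)) by apply filter_filter'.
  assert (Hin : filter_prod (lo_filter g) (hi_filter g) (fun ab =>
    (Rbar_lt (lo g) (fst ab) /\ Rbar_lt (fst ab) (hi g)) /\
    (Rbar_lt (lo g) (snd ab) /\ Rbar_lt (snd ab) (hi g)))).
  { apply Filter_prod with (1 := lo_filter_inside g) (2 := hi_filter_inside g).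
    intros x y Hx Hy; exact (conj Hx Hy). }
  assert (HfP := Hf P HP); unfold filtermapi in HfP |- *.
  generalize (filter_and _ _ HfP Hin); apply filter_imp.
  intros [x y] [[w [Hw HPw]] [[Hx1 Hx2] [Hy1 Hy2]]]; simpl in *.
  exists w; split; [|exact HPw]; simpl.
  destruct (HD (Rmin x y) (Rmax x y)) as [l Hl].
  - unfold Rmin; destruct (Rle_dec x y); assumption.
  - unfold Rmax; destruct (Rle_dec x y); assumption.
  - apply is_RInt_ext_finite with (l := l) (2 := Hw).
    intros t Ht Htl; rewrite Hfh by (apply Hl; assumption); reflexivity.
Qed.

Lemma rcpow_mult_zpow : forall (lam : R) (z : log_surface) (w : C),
  rcpow lam w * zpow z w = zpow (scale lam z) w.
Proof.
  intros lam z w; unfold rcpow, zpow; simpl; rewrite <- Cexp_plus.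
  f_equal; ring.
Qed.

Lemma absorbs_of_pointwise : forall (mult f : C -> C) (cst : C) (lam : R)
    (f' D : C -> C),
  cst <> 0 ->
  (forall s, D s <> 0 -> mult s * f s = cst * rcpow lam (- s) * f' s) ->
  absorbs mult f cst lam f' D.
Proof.
  intros mult f cst lam f' D Hcst Hpt; split; [exact Hpt|].
  intros g z HD.
  set (F := fun s => mult s * f s * zpow z (- s)).
  set (F' := fun s => f' s * zpow (scale lam z) (- s)).
  assert (HFF' : forall s, D s <> 0 -> F s = cst * F' s).
  { intros s Hs; unfold F, F'; rewrite (Hpt s Hs), <- rcpow_mult_zpow; ring. }
  assert (HF1 : Filter (lo_filter g)) by apply filter_filter'.
  assert (HF2 : Filter (hi_filter g)) by apply filter_filter'.
  assert (Hback : forall v,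
    is_RInt_gen (V := C_R_NormedModule) (fun t => F' (path g t) * velocity g t)
      (lo_filter g) (hi_filter g) v ->
    is_RInt_gen (V := C_R_NormedModule) (fun t => F (path g t) * velocity g t)
      (lo_filter g) (hi_filter g) (cst * v)).
  { intros v Hv; apply (is_contour_int_ext g D (fun s => cst * F' s) F _ HD).
    - intros s Hs; symmetry; apply HFF', Hs.
    - apply is_RInt_gen_ext with (fun t => cst * (F' (path g t) * velocity g t)).
      + apply filter_forall; intros ab t _; apply Cmult_assoc.
      + now apply is_RInt_gen_Cmult. }
  split; [split|].
  - intros [v Hv]; exists (/ cst * v).
    apply (is_contour_int_ext g D (fun s => / cst * F s) F' _ HD).
    + intros s Hs; rewrite (HFF' s Hs); field; exact Hcst.
    + apply is_RInt_gen_ext with (fun t => / cst * (F (path g t) * velocity g t)).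
      * apply filter_forall; intros ab t _; apply Cmult_assoc.
      * now apply is_RInt_gen_Cmult.
  - intros [v Hv]; exists (cst * v); now apply Hback.
  - intros [v Hv].
    assert (E : contour_int g F = cst * v).
    { exact (is_RInt_gen_unique (V := C_R_CompleteNormedModule)
               _ _ (Hback v Hv)). }
    assert (E' : contour_int g F' = v).
    { exact (is_RInt_gen_unique (V := C_R_CompleteNormedModule) _ _ Hv). }
    unfold K_int; fold F; fold F'; rewrite E, E'; ring.
Qed.

(** * The four multipliers *)

Theorem lemma10p1 :
  forall (tau c1 c2 : R), (0 < tau)%R -> barnes_constants tau c1 c2 ->
  forall (m n p q : nat) (a b : list C) (alpha c : C),
  (m <= q)%nat -> (n <= p)%nat -> length a = p -> length b = q ->
  let G := barnes_G tau c1 c2 in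
  let kappa : C := Rpower (2 * PI) ((1 - tau) / 2) in
  (forall a' b' : list C,
     add_den n c a a' -> add_num m (c + tau) b b' ->
     absorbs (fun s => Gamma (c - s)) (phi G tau alpha m n a b)
       (kappa * rcpow tau (c - 1 / 2)) tau
       (phi G tau alpha (S m) n a' b') (phi_den G tau (S m) n a' b')) /\
  (forall a' b' : list C,
     add_num n (1 - c) a a' -> add_den m (1 + tau - c) b b' ->
     absorbs (fun s => Gamma (c + s)) (phi G tau alpha m n a b)
       (kappa * rcpow tau (c - 1 / 2)) (/ tau)
       (phi G tau alpha m (S n) a' b') (phi_den G tau m (S n) a' b')) /\
  (forall a' b' : list C,
     add_den n (c + tau) a a' -> add_num m c b b' ->
     absorbs (fun s => / Gamma (c - s)) (phi G tau alpha m n a b)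
       (/ kappa * rcpow tau (1 / 2 - c)) (/ tau)
       (phi G tau alpha (S m) n a' b') (phi_den G tau (S m) n a' b')) /\
  (forall a' b' : list C,
     add_num n (1 + tau - c) a a' -> add_den m (1 - c) b b' ->
     absorbs (fun s => / Gamma (c + s)) (phi G tau alpha m n a b)
       (/ kappa * rcpow tau (1 / 2 - c)) tau
       (phi G tau alpha m (S n) a' b') (phi_den G tau m (S n) a' b')).
Proof.
  intros tau c1 c2 Htau HG m n p q a b alpha c _ _ _ _ G kappa.
  assert (Hkappa : kappa <> 0) by apply RtoC_Rpower_neq_0.
  assert (Hkappa' : / kappa <> 0).
  { intros H; apply C1_nz; rewrite <- (Cinv_r kappa Hkappa), H; ring. }
  assert (HGam : forall z, G z <> 0 ->
    Gamma z = kappa * rcpow tau (z - 1 / 2) * (G (z + tau) / G z)).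
  { intros z; now apply Gamma_eq_barnes_quotient. }
  assert (HInv : forall z, G (z + tau) <> 0 ->
    / Gamma z = / kappa * rcpow tau (1 / 2 - z) * (G z / G (z + tau))).
  { intros z; now apply inv_Gamma_eq_barnes_quotient. }
  refine (conj _ (conj _ (conj _ _))); intros a' b' Ha Hb; apply absorbs_of_pointwise;
    try (apply Cmult_neq_0; auto using rcpow_neq_0); intros s Hs.
  - rewrite (phi_add_den_num _ _ _ _ _ _ _ _ _ _ _ _ Ha Hb Hs).
    rewrite (phi_den_add_den_num _ _ _ _ _ _ _ _ _ _ _ Ha Hb) in Hs.
    rewrite HGam by exact (Cmult_neq_0_l _ _ Hs).
    replace (c - s - 1 / 2) with (c - 1 / 2 + - s) by ring.
    rewrite rcpow_plus.
    replace (c - s + tau) with (c + tau - s) by ring.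
    ring.
  - rewrite (phi_add_num_den _ _ _ _ _ _ _ _ _ _ _ _ Ha Hb Hs).
    rewrite (phi_den_add_num_den _ _ _ _ _ _ _ _ _ _ _ Ha Hb) in Hs.
    replace (1 + tau - (1 + tau - c) + s) with (c + s) in * by ring.
    replace (1 + tau - (1 - c) + s) with (c + s + tau) by ring.
    rewrite HGam by exact (Cmult_neq_0_l _ _ Hs).
    rewrite rcpow_Rinv by exact Htau.
    replace (c + s - 1 / 2) with (c - 1 / 2 + - - s) by ring.
    rewrite rcpow_plus; ring.
  - rewrite (phi_add_den_num _ _ _ _ _ _ _ _ _ _ _ _ Ha Hb Hs).
    rewrite (phi_den_add_den_num _ _ _ _ _ _ _ _ _ _ _ Ha Hb) in Hs.
    replace (c + tau - s) with (c - s + tau) in * by ring.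
    rewrite HInv by exact (Cmult_neq_0_l _ _ Hs).
    rewrite rcpow_Rinv by exact Htau.
    replace (1 / 2 - (c - s)) with (1 / 2 - c + - - s) by ring.
    rewrite rcpow_plus; ring.
  - rewrite (phi_add_num_den _ _ _ _ _ _ _ _ _ _ _ _ Ha Hb Hs).
    rewrite (phi_den_add_num_den _ _ _ _ _ _ _ _ _ _ _ Ha Hb) in Hs.
    replace (1 + tau - (1 - c) + s) with (c + s + tau) in * by ring.
    replace (1 + tau - (1 + tau - c) + s) with (c + s) by ring.
    rewrite HInv by exact (Cmult_neq_0_l _ _ Hs).
    replace (1 / 2 - (c + s)) with (1 / 2 - c + - s) by ring.
    rewrite rcpow_plus; ring.
Qed.
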